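(* Let $S\neq\mathbb{N}$ be a numerical semigroup with minimal set of generators $g_0<g_1<\cdots<g_d$, let $c$ be the conductor of $S$ and let $\Omega:=\#(\mathbb{N}\setminus S)$. If $S$ is $A$-graded, then Wilf's inequality \[\frac{\Omega}{c}\leq\frac{d}{d+1}\] holds.
   Context: $\mathbb{N}=\{0,1,2,\ldots\}$. A numerical semigroup is a submonoid $S$ of $(\mathbb{N},+)$ with finite complement $\mathbb{N}\setminus S$; it has a unique minimal set of generators, here written $g_0<g_1<\cdots<g_d$. The conductor $c$ is the integer such that $c-1$ is the largest integer not contained in $S$. Set $n_0:=\lceil c/g_0\rceil$ and $\rho:=n_0g_0-c$, so $0\leq\rho<g_0$. The Apéry set of $S$ is $A:=\{s\in S\mid s-g_0\notin S\}$. For $i\in\mathbb{N}$ let \[A_i:=\left\{a\in A\ \middle|\ \left\lfloor\frac{a+\rho}{g_0}\right\rfloor=i\right\}.\] $S$ is called $A$-graded if $(A_i+A_j)\cap A\subseteq A_{i+j}$ for all $i,j\in\mathbb{N}$, where $A_i+A_j=\{a+b\mid a\in A_i,\ b\in A_j\}$. *)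

(* Defs.v *)
From mathcomp Require Import all_boot all_order all_algebra finmap.
From mathcomp Require Import boolp classical_sets functions cardinality.

Set Implicit Arguments.
Unset Strict Implicit.
Unset Printing Implicit Defensive.

Local Open Scope classical_set_scope.
Local Open Scope nat_scope.

Definition numerical_semigroup (S : set nat) : Prop :=
  [/\ S 0, forall a b, S a -> S b -> S (a + b) & finite_set (~` S)].

(* The submonoid of (nat, +) generated by G: all finite sums of elements of G,
   repetitions allowed. *)
Definition monoid_span (G : set nat) : set nat :=
  [set sumn s | s in [set s : seq nat | forall x, x \in s -> G x]].

Definition minimal_generating_set (S G : set nat) : Prop :=
  monoid_span G = S /\
  forall H : set nat, H `<=` G -> monoid_span H = S -> H = G.

(* c - 1 is the largest integer outside S. For c = 0 that integer is -1, so
   only the first clause constrains S, and S is all of nat. *)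
Definition is_conductor (S : set nat) (c : nat) : Prop :=
  (forall n, c <= n -> S n) /\ (0 < c -> ~ S c.-1).

Definition genus (S : set nat) : nat := #|` fset_set (~` S)|.

Definition ceil_divn (m n : nat) : nat := (m + n.-1) %/ n.

Lemma ceil_divnP m n : 0 < n -> m <= ceil_divn m n * n < m + n.
Proof.
rewrite /ceil_divn; case: n => // n _ /=.
have h := divn_eq (m + n) n.+1; have := ltn_pmod (m + n) (ltn0Sn n).
set r := _ %% _ in h *; set q := _ * _ in h *; rewrite ltnS => r_le.
apply/andP; split; first by rewrite -(leq_add2r n) h leq_add2l.
by rewrite addnS ltnS h leq_addr.
Qed.

Definition rho (g0 c : nat) : nat := ceil_divn c g0 * g0 - c.

(* s - g0 is a difference of integers: it lies outside S when it is negative. *)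
Definition Apery (S : set nat) (g0 : nat) : set nat :=
  [set s | S s /\ ~ (g0 <= s /\ S (s - g0))].

Definition Apery_level (S : set nat) (g0 c i : nat) : set nat :=
  [set a | Apery S g0 a /\ (a + rho g0 c) %/ g0 = i].

Definition A_graded (S : set nat) (g0 c : nat) : Prop :=
  forall i j : nat,
    [set a + b | a in Apery_level S g0 c i & b in Apery_level S g0 c j]
      `&` Apery S g0 `<=` Apery_level S g0 c (i + j).

(* Main.v *)
Require Import Defs.
From mathcomp Require Import all_boot all_order all_algebra finmap.
From mathcomp Require Import boolp classical_sets functions cardinality.
From mathcomp Require Import zify.

Set Implicit Arguments.
Unset Strict Implicit.
Unset Printing Implicit Defensive.

Import GRing.Theory Num.Theory.

(** Write m for the least generator, A for the Apery set, n0 for the ceiling of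
    c / m, and lambda for the level on A, so that a lies in A_(lambda a).

    Every a in A is a combination of the d generators other than m.  Choosing
    for each a a factorization that is minimal for a linear code gives a set M
    of exponent vectors in N^d that is in bijection with A and is closed under
    decreasing coordinates ([standard_vectors]); this is the usual passage to
    standard monomials.  When S is A-graded, lambda becomes a weighted degree
    on M: lambda a = sum_j u_j lambda_j, where lambda_j is the level of the
    j-th generator ([level_dot]).

    The heart of the argument is an inequality for such an order ideal M on
    which a weighted degree is bounded by q ([sum_dot_coord_le]).  Fix a
    direction j.  Each line parallel to the j-th axis meets M in an initial
    segment, and reversing these segments is an involution of M.  The degree of
    u plus the j-contribution of the reflected vector is the degree of the top
    of the line of u, hence is at most q.  So the average over M of
    (degree + j-contribution) is at most q, and summing over the d directions
    gives (d + 1) sum_M degree <= d q |M|.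

    With q = n0 this says that the sum over A of n0 - lambda a is at least
    n0 |A| / (d + 1), where n0 |A| >= n0 m >= c.  That sum counts the pairs
    (a, k) with k < n0 - lambda a, which (a, k) |-> a + k m sends injectively
    to the elements of S below c.  So at least c / (d + 1) of the c integers
    below c belong to S, which is Wilf's inequality. *)

(** * Weighted degrees of exponent vectors *)

Definition dot d (e u : 'I_d -> nat) : nat := \sum_i u i * e i.

Lemma eq_dot d (e u v : 'I_d -> nat) : u =1 v -> dot e u = dot e v.
Proof. by move=> uv; apply: eq_bigr => i _; rewrite uv. Qed.

Lemma dotD d (e u v : 'I_d -> nat) :
  dot e (fun i => u i + v i) = dot e u + dot e v.
Proof. by rewrite -big_split; apply: eq_bigr => i _; rewrite mulnDl. Qed.

Lemma leq_coord_dot d (e u : 'I_d -> nat) i : 0 < e i -> u i <= dot e u.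
Proof.
move=> e_gt0; rewrite /dot (bigD1 i) //=.
by apply: leq_trans (leq_addr _ _); rewrite leq_pmulr.
Qed.

Lemma dot_digits_inj d b (u v : 'I_d -> nat) :
    (forall i, u i < b) -> (forall i, v i < b) ->
    dot (fun i => b ^ i) u = dot (fun i => b ^ i) v ->
  u =1 v.
Proof.
elim: d u v => [|d IHd] u v u_lt v_lt; first by move=> _ [].
have dotE w : dot (fun i : 'I_d.+1 => b ^ i) w =
    dot (fun i : 'I_d => b ^ i) (fun i => w (lift ord0 i)) * b + w ord0.
  rewrite /dot big_ord_recl expn0 muln1 addnC big_distrl /=; congr (_ + _).
  by apply: eq_bigr => i _; rewrite /bump leq0n add1n expnSr mulnA.
have b_gt0 : 0 < b by apply: leq_ltn_trans (u_lt ord0).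
rewrite !dotE => eq_uv.
have eq0 : u ord0 = v ord0.
  have := congr1 (modn^~ b) eq_uv.
  by rewrite !modnMDl !modn_small.
move/eqP: eq_uv; rewrite eq0 eqn_add2r eqn_pmul2r // => /eqP eq_uv.
move=> i; have [j ->|->//] := unliftP ord0 i.
by apply: (IHd (fun i => u (lift ord0 i)) (fun i => v (lift ord0 i))).
Qed.

Local Notation vdot e u := (dot e (fun i => nat_of_ord (u i))).

(** * Reflection along coordinate lines of an order ideal *)

Section OrderIdeal.

Variables d N : nat.
Local Notation vec := {ffun 'I_d -> 'I_N.+1}.
Implicit Types (u v : vec) (M : {set vec}).

Definition order_ideal M :=
  forall u v, u \in M -> (forall i, v i <= u i) -> v \in M.

Definition set_coord u j (k : nat) : vec :=
  [ffun i => if i == j then inord k else u i].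

(** The line through u parallel to the j-th axis meets an order ideal in an
    initial segment, so its largest j-coordinate describes that intersection. *)
Definition line_top M j u : nat :=
  \max_(k < N.+1 | set_coord u j k \in M) k.

Definition line_reflect M j u : vec := set_coord u j (line_top M j u - u j).

Lemma set_coordK u j k l : set_coord (set_coord u j k) j l = set_coord u j l.
Proof. by apply/ffunP => i; rewrite !ffunE; case: eqP. Qed.

Lemma set_coord_id u j : set_coord u j (u j) = u.
Proof. by apply/ffunP => i; rewrite !ffunE; case: eqP => // ->; rewrite inord_val. Qed.

Lemma line_top_set_coord M j u k :
  line_top M j (set_coord u j k) = line_top M j u.
Proof. by apply: eq_bigl => l; rewrite set_coordK. Qed.

Lemma line_topP M j u : u \in M ->
  [/\ u j <= line_top M j u, line_top M j u <= N
    & set_coord u j (line_top M j u) \in M].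
Proof.
move=> uM.
have uj_line : set_coord u j (u j) \in M by rewrite set_coord_id.
split.
- exact: (bigmax_sup (u j)).
- by apply/bigmax_leqP => k _; rewrite -ltnS.
- by rewrite /line_top (bigmax_eq_arg (u j)) //; case: arg_maxnP.
Qed.

Lemma line_reflect_coord M j u : u \in M ->
  line_reflect M j u j = line_top M j u - u j :> nat.
Proof.
case/(line_topP j) => _ topN _.
by rewrite ffunE eqxx inordK // ltnS (leq_trans (leq_subr _ _)).
Qed.

(** The reflection of u lies below the top of its line, so it stays in M; it has
    the same line, hence the same top, so reflecting twice is the identity. *)
Lemma line_reflectP M j u : order_ideal M -> u \in M ->
  line_reflect M j u \in M /\ line_reflect M j (line_reflect M j u) = u.
Proof.
move=> idM uM; have [uj_top topN topM] := line_topP j uM; split.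
  apply: idM topM _ => i; rewrite !ffunE; case: eqP => // _.
  by rewrite !inordK // ?ltnS ?leq_subr // (leq_trans (leq_subr _ _)).
rewrite {1}/line_reflect line_reflect_coord // line_top_set_coord set_coordK.
by rewrite subKn // set_coord_id.
Qed.

(** A point and its reflection have j-coordinates adding up to that of the top
    of their line, and the other coordinates are constant on the line. *)
Lemma dot_line_top M j u (e : 'I_d -> nat) : u \in M ->
  vdot e u + line_reflect M j u j * e j =
    vdot e (set_coord u j (line_top M j u)).
Proof.
move=> uM; have [uj_top topN _] := line_topP j uM.
rewrite line_reflect_coord // /dot (bigD1 j) //= [RHS](bigD1 j) //=.
rewrite addnAC -mulnDl subnKC // ffunE eqxx inordK //; congr (_ + _).
by apply: eq_bigr => i /negPf ij; rewrite ffunE ij.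
Qed.

(** Reindexing by the line reflection replaces the j-contribution of u by that
    of its reflection, after which every summand is the degree of a vector
    of M. *)
Lemma sum_dot_coord_le M j (e : 'I_d -> nat) q :
    order_ideal M -> (forall u, u \in M -> vdot e u <= q) ->
  \sum_(u in M) (vdot e u + u j * e j) <= #|M| * q.
Proof.
move=> idM le_q.
have -> : \sum_(u in M) (vdot e u + u j * e j) =
          \sum_(u in M) (vdot e u + line_reflect M j u j * e j).
  rewrite !big_split /=; congr (_ + _).
  (* Outside M the reflection need not be involutive, so membership is recovered
     from the fixed-point condition of the reindexing. *)
  rewrite (reindex_onto (line_reflect M j) (line_reflect M j)) /=; last first.
    by move=> u /(line_reflectP j idM)[].
  apply: eq_bigl => u; apply/andP/idP => [[ruM /eqP <-]|uM].
    by have [] := line_reflectP j idM ruM.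
  by have [-> ->] := line_reflectP j idM uM.
rewrite -sum_nat_const; apply: leq_sum => u uM.
by rewrite dot_line_top // le_q //; have [] := line_topP j uM.
Qed.

(** The j-contributions add up to the degree, so summing the one-direction
    bound over all j counts each degree d + 1 times. *)
Lemma order_ideal_sum_dot_le M (e : 'I_d -> nat) q :
    order_ideal M -> (forall u, u \in M -> vdot e u <= q) ->
  d.+1 * \sum_(u in M) vdot e u <= d * (#|M| * q).
Proof.
move=> idM le_q.
have -> : d.+1 * \sum_(u in M) vdot e u =
    \sum_(j < d) \sum_(u in M) (vdot e u + u j * e j).
  rewrite [RHS]exchange_big /= big_distrr; apply: eq_bigr => u _ /=.
  by rewrite big_split /= big_const_ord iter_addn_0 mulSn addnC mulnC.
rewrite mulnC -iter_addn_0 -big_const_ord; apply: leq_sum => j _.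
exact: sum_dot_coord_le.
Qed.

End OrderIdeal.

(** * Standard factorizations *)

(** Among the factorizations of each value, keep the one with least code, the
    code being the base N + 1 number whose digits are the exponents.  The code is
    injective, so factorizations become unique.  It is additive, so the kept
    factorizations form an order ideal: if v <= u and w were a cheaper
    factorization with the value of v, then u - v + w would be a cheaper one
    with the value of u. *)
Lemma standard_vectors d N (h : 'I_d -> nat) (A : pred nat) :
    (forall i, 0 < h i) -> (forall a, A a -> a <= N) ->
    (forall u v : 'I_d -> nat,
       (forall i, v i <= u i) -> A (dot h u) -> A (dot h v)) ->
    (forall a, A a -> exists u, dot h u = a) ->
  exists M : {set {ffun 'I_d -> 'I_N.+1}},
    [/\ order_ideal M, {in M &, injective (fun u : {ffun 'I_d -> 'I_N.+1} => vdot h u)},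
        forall u, u \in M -> A (vdot h u)
      & forall a, A a -> exists2 u, u \in M & vdot h u = a].
Proof.
move=> h_gt0 A_le A_down A_gen.
pose code (u : {ffun 'I_d -> 'I_N.+1}) := vdot (fun i => N.+1 ^ i) u.
pose fibre_min (u w : {ffun 'I_d -> 'I_N.+1}) := (vdot h w == vdot h u) ==> (code u <= code w).
(* Exponents of an element of A are at most its value, since weights are positive,
   so they fit in the box. *)
have lift_vec (u : 'I_d -> nat) : A (dot h u) ->
    exists w : {ffun 'I_d -> 'I_N.+1}, forall i, w i = u i :> nat.
  move=> Au; exists [ffun i => inord (u i)] => i.
  rewrite ffunE inordK // ltnS; apply: leq_trans (A_le _ Au).
  exact: leq_coord_dot.
exists [set u : {ffun 'I_d -> 'I_N.+1} | A (vdot h u) && [forall w, fibre_min u w]]; split.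
- move=> u v; rewrite !inE => /andP[Au /forallP u_min] vu.
  rewrite (A_down (fun i => u i) (fun i => v i)) //=; apply/forallP => w; apply/implyP => /eqP wv.
  have dot_exch e : dot e (fun i => (u i - v i) + w i) + vdot e v = vdot e u + vdot e w.
    rewrite -!dotD; apply: eq_dot => i /=; have := vu i; lia.
  have eq_h : dot h (fun i => (u i - v i) + w i) = vdot h u.
    by apply: (@addIn (vdot h v)); rewrite dot_exch wv.
  have [x xE] : exists x : {ffun 'I_d -> 'I_N.+1},
      forall i, x i = (u i - v i) + w i :> nat by apply: lift_vec; rewrite eq_h.
  have xu e : vdot e x = dot e (fun i => (u i - v i) + w i) by apply: eq_dot.
  have := u_min x; rewrite /fibre_min xu eq_h eqxx /= /code xu.
  by rewrite -(leq_add2r (code v)) dot_exch leq_add2l.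
- move=> u v; rewrite !inE => /andP[_ /forallP u_min] /andP[_ /forallP v_min] uv.
  have := u_min v; have := v_min u; rewrite /fibre_min uv eqxx /= => vu uv'.
  have /dot_digits_inj E : code u = code v by apply/eqP; rewrite eqn_leq vu uv'.
  by apply/ffunP => i; apply: val_inj; apply: E => k; apply: ltn_ord.
- by move=> u; rewrite inE => /andP[].
- move=> a Aa; have [u0 u0a] := A_gen a Aa.
  have [u1 u1E] : exists w : {ffun 'I_d -> 'I_N.+1}, forall i, w i = u0 i :> nat.
    by apply: lift_vec; rewrite u0a.
  have u1a : vdot h u1 == a by rewrite (eq_dot h u1E) u0a.
  case: (@arg_minnP _ u1 (fun w : {ffun 'I_d -> 'I_N.+1} => vdot h w == a) code u1a).
  move=> u /eqP ua u_min; exists u => //.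
  rewrite inE ua Aa /=; apply/forallP => w; apply/implyP.
  by rewrite ua; apply: u_min.
Qed.

(** Transport of the order ideal inequality along the bijection between values
    and standard factorizations, for a level function that is a weighted degree
    on factorizations. *)
Lemma graded_sum_le d N (h : 'I_d -> nat) (A : pred nat) (lev : nat -> nat) q :
    (forall i, 0 < h i) -> (forall a, A a -> a <= N) ->
    (forall u v : 'I_d -> nat,
       (forall i, v i <= u i) -> A (dot h u) -> A (dot h v)) ->
    (forall a, A a -> exists u, dot h u = a) ->
    (forall u, A (dot h u) -> lev (dot h u) = dot (fun i => lev (h i)) u) ->
    (forall a, A a -> lev a <= q) ->
  d.+1 * \sum_(a < N.+1 | A a) lev a <= d * (#|[set a : 'I_N.+1 | A a]| * q).
Proof.
move=> h_gt0 A_le A_down A_gen lev_dot lev_le.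
have [M [idM injM MA AM]] := standard_vectors h_gt0 A_le A_down A_gen.
pose value (u : {ffun 'I_d -> 'I_N.+1}) : 'I_N.+1 := inord (vdot h u).
have valueE u : u \in M -> value u = vdot h u :> nat.
  by move=> uM; rewrite inordK // ltnS; apply/A_le/MA.
have value_inj : {in M &, injective value}.
  move=> u v uM vM /(congr1 (@nat_of_ord _)); rewrite !valueE //.
  exact: injM.
have imM : [set a : 'I_N.+1 | A a] = [set value u | u in M].
  apply/setP => a; rewrite inE; apply/idP/imsetP => [Aa|[u uM ->]].
    by have [u uM ua] := AM _ Aa; exists u => //; apply: val_inj; rewrite /= valueE.
  by rewrite valueE // MA.
have -> : \sum_(a < N.+1 | A a) lev a = \sum_(a in [set value u | u in M]) lev a.
  by rewrite -imM; apply: eq_bigl => a; rewrite inE.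
rewrite imM card_in_imset // big_imset //=.
rewrite (eq_bigr (fun u : {ffun _} => vdot (fun i => lev (h i)) u)) => [|u uM].
  by apply: order_ideal_sum_dot_le => // u uM; rewrite -lev_dot ?lev_le ?MA.
by rewrite valueE // lev_dot // MA.
Qed.

(** * The Apery set of a numerical semigroup *)

Section AperySet.

Variables (S : set nat) (m c : nat).
Hypotheses (S_sgp : numerical_semigroup S) (m_gt0 : 0 < m) (Sm : S m).
Hypothesis c_cond : is_conductor S c.

Local Notation n0 := (ceil_divn c m).
Local Notation level a := ((a + rho m c) %/ m).
Local Notation inS := (fun n => `[< S n >]).
Local Notation inA := (fun a => `[< Apery S m a >]).

Lemma rho_bound : c + rho m c = n0 * m /\ rho m c < m.
Proof. by have := ceil_divnP c m_gt0; rewrite /rho; lia. Qed.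

Lemma semigroupMn x k : S x -> S (k * x).
Proof.
have [S0 SD _] := S_sgp.
by move=> Sx; elim: k => // k IHk; rewrite mulSn; apply: SD.
Qed.

(** If x - m were in S, then so would be x + y - m. *)
Lemma Apery_summand x y : S x -> S y -> Apery S m (x + y) -> Apery S m x.
Proof.
have [S0 SD _] := S_sgp.
move=> Sx Sy [_ notS]; split=> // -[mx Sxm]; apply: notS.
by rewrite -addnBAC //; split; [lia | apply: SD].
Qed.

Lemma Apery_lt a : Apery S m a -> a < c + m.
Proof.
case=> Sa notS; rewrite ltnNge; apply/negP => le_a; apply: notS; split; first lia.
by apply: c_cond.1; lia.
Qed.

(** Elements of A are below c + m, and c + rho = n0 m. *)
Lemma Apery_level_le a : Apery S m a -> level a <= n0.
Proof.
move=> /Apery_lt a_lt; have [cE _] := rho_bound.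
rewrite -ltnS ltn_divLR // mulSn -cE; lia.
Qed.

(** If x < y are congruent mod m and x is in S, then y - m is x plus a multiple
    of m, hence is in S. *)
Lemma Apery_mod_inj a b : Apery S m a -> Apery S m b -> a = b %[mod m] -> a = b.
Proof.
suff le_mod x y : Apery S m x -> Apery S m y -> x = y %[mod m] -> y <= x.
  by move=> Aa Ab ab; apply/eqP; rewrite eqn_leq !le_mod.
move=> [Sx _] [_ notS] xy; rewrite leqNgt; apply/negP => lt_xy; apply: notS.
have := divn_eq x m; have := divn_eq y m; rewrite xy.
set r := _ %% _; set p := y %/ m; set q := x %/ m => yE xE.
have q_lt : q < p by rewrite -(ltn_pmul2r m_gt0); lia.
have [t pE] : exists t, p * m = t * m + q * m + m.
  by exists (p - q.+1); rewrite -mulnDl -mulSnr; congr (_ * _); lia.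
split; first lia.
have -> : y - m = t * m + x by lia.
have [_ SD _] := S_sgp; apply: SD => //; exact: semigroupMn.
Qed.

Lemma Apery_mod_ex r : r < m -> exists2 a, Apery S m a & a %% m = r.
Proof.
move=> r_lt.
have Sex : exists k, `[< S (k * m + r) >].
  (* Since m > 0, c * m + r is at least c. *)
  by exists c; apply/asboolP/c_cond.1; nia.
case: (ex_minnP Sex) => k /asboolP Sk k_min; exists (k * m + r); last first.
  by rewrite modnMDl modn_small.
split=> // -[m_le Sk1]; case: k => [|k] in Sk k_min m_le Sk1; first by lia.
have /k_min : `[< S (k * m + r) >].
  by apply/asboolP; move: Sk1; rewrite mulSn -addnA addKn.
by rewrite ltnn.
Qed.

Lemma card_Apery_ge : m <= #|[set a : 'I_(c + m).+1 | inA a]|.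
Proof.
pose w (r : 'I_m) : 'I_(c + m).+1 := inord (s2val (cid2 (Apery_mod_ex (ltn_ord r)))).
have wP r : Apery S m (w r) /\ w r %% m = r.
  rewrite /w; case: cid2 => a /= Aa ar; rewrite inordK //.
  by have := Apery_lt Aa; lia.
have w_inj : injective w.
  move=> r s rs; apply: val_inj => /=.
  by rewrite -(wP r).2 -(wP s).2 rs.
rewrite -[leqLHS](card_ord m) -(card_codom w_inj); apply: subset_leq_card.
by apply/fintype.subsetP => _ /codomP[r ->]; rewrite inE; apply/asboolP; case: (wP r).
Qed.

(** The left side counts the pairs (a, k) with k < n0 - level a, and the map
    (a, k) |-> a + k m is injective because a is determined by its residue.
    Its values are below c because c + rho = n0 m. *)
Lemma sum_colevel_le :
  \sum_(a < (c + m).+1 | inA a) (n0 - level a) <= #|[set s : 'I_c | inS s]|.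
Proof.
pose P : {set 'I_(c + m).+1 * 'I_n0} :=
  [set p : 'I_(c + m).+1 * 'I_n0 | inA p.1 && (p.2 < n0 - level p.1)].
have -> : \sum_(a < (c + m).+1 | inA a) (n0 - level a) = #|P|.
  rewrite -sum1_card (eq_bigr (fun a : 'I_ _ => \sum_(k < n0 | k < n0 - level a) 1)).
    rewrite pair_big_dep /=; apply: eq_bigl => -[a k] /=.
    by rewrite inE.
  move=> a _; rewrite (big_ord_narrow (F := fun _ => 1)) ?leq_subr //.
  by rewrite sum1_card card_ord.
have [cE _] := rho_bound.
have P_lt p : p \in P -> p.1 + p.2 * m < c.
  rewrite inE => /andP[_ lt_p]; rewrite -(ltn_add2r (rho m c)) cE.
  have : level p.1 + p.2 < n0 by rewrite -ltn_subRL.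
  by rewrite addnC -divnMDl // ltn_divLR // addnA [_ * m + _]addnC.
have [P0|[p0 p0P]] := set_0Vmem P; first by rewrite P0 cards0.
have c_gt0 : 0 < c by apply: leq_ltn_trans (P_lt _ p0P).
pose f (p : 'I_(c + m).+1 * 'I_n0) : 'I_c := insubd (Ordinal c_gt0) (p.1 + p.2 * m).
have fE p : p \in P -> f p = p.1 + p.2 * m :> nat.
  by move=> pP; rewrite val_insubd P_lt.
have f_inj : {in P &, injective f}.
  move=> p q pP qP /(congr1 (@nat_of_ord _)); rewrite !fE // => pq.
  move: (pP) (qP); rewrite !inE => /andP[/asboolP Ap _] /andP[/asboolP Aq _].
  have eq1 : p.1 = q.1 :> nat.
    apply: Apery_mod_inj => //.
    by rewrite -(modnMDl p.2) addnC pq addnC modnMDl.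
  have eq2 : p.2 = q.2 :> nat.
    by apply/eqP; rewrite -(eqn_pmul2r m_gt0) -(eqn_add2l p.1) pq eq1.
  by rewrite [p]surjective_pairing [q]surjective_pairing; congr pair; apply: val_inj.
rewrite -(card_in_imset f_inj); apply: subset_leq_card.
apply/fintype.subsetP => _ /imsetP[p pP ->]; rewrite inE; apply/asboolP.
rewrite fE //; move: pP; rewrite inE => /andP[/asboolP[Sp _] _].
have [_ SD _] := S_sgp; apply: SD => //; exact: semigroupMn.
Qed.

Lemma genus_card_below : genus S + #|[set s : 'I_c | inS s]| = c.
Proof.
have -> : #|[set s : 'I_c | inS s]| = count inS (iota 0 c).
  rewrite -sum1_card -sum1_count -[X in iota 0 X]subn0 -/(index_iota 0 c) big_mkord.
  by apply: eq_bigl => s; rewrite inE.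
rewrite -[RHS](size_iota 0 c) -(count_predC inS) addnC; congr (_ + _).
have [_ _ S_fin] := S_sgp; rewrite /genus.
have -> : fset_set (~` S)%classic =
    [fset x in [seq n <- iota 0 c | ~~ inS n]]%fset.
  apply/fsetP => x; rewrite in_fset_set // in_fset mem_filter mem_iota /=.
  apply/idP/andP => [|[/asboolPn notSx _]]; last by rewrite inE.
  rewrite inE => notSx; split; first exact/asboolPn.
  by rewrite add0n ltnNge; apply/negP => /c_cond.1.
by rewrite card_fseq undup_id ?filter_uniq ?iota_uniq // size_filter.
Qed.

(** * Wilf's inequality for A-graded semigroups *)

Section Graded.

Hypothesis S_graded : A_graded S m c.

Lemma levelD x y : S x -> S y -> Apery S m (x + y) ->
  level (x + y) = level x + level y.
Proof.
move=> Sx Sy Axy; have Ax := Apery_summand Sx Sy Axy.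
have Ay : Apery S m y by apply: (Apery_summand Sy Sx); rewrite addnC.
have [] // := S_graded (i := level x) (j := level y) (t := x + y).
by split=> //; exists x => //; exists y.
Qed.

Lemma level0 : level 0 = 0.
Proof. by rewrite add0n divn_small //; case: rho_bound. Qed.

Lemma levelMn x k : S x -> Apery S m (k * x) -> level (k * x) = k * level x.
Proof.
move=> Sx; elim: k => [|k IHk] Akx; first by rewrite !mul0n level0.
have Skx := semigroupMn k Sx.
rewrite !mulSn levelD -?mulSn // IHk //.
by apply: (Apery_summand Skx Sx); rewrite addnC -mulSn.
Qed.

Lemma semigroup_dot d (h u : 'I_d -> nat) : (forall i, S (h i)) -> S (dot h u).
Proof.
have [S0 SD _] := S_sgp.
by move=> Sh; apply: big_ind => // i _; apply: semigroupMn.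
Qed.

(** All partial sums of an element of A are in A, so [levelD] applies at every
    step of the sum. *)
Lemma level_dot d (h u : 'I_d -> nat) :
    (forall i, S (h i)) -> Apery S m (dot h u) ->
  level (dot h u) = dot (fun i => level (h i)) u.
Proof.
have [S0 SD _] := S_sgp.
move=> Sh; rewrite /dot; elim: (index_enum _) => [|i r IHr].
  by rewrite !big_nil level0.
have Sr : S (\sum_(j <- r) u j * h j).
  by apply: big_ind => // j _; apply: semigroupMn.
have Si : S (u i * h i) by apply: semigroupMn.
rewrite !big_cons => Air; rewrite levelD // IHr; last first.
  by apply: (Apery_summand Sr Si); rewrite addnC.
by rewrite levelMn //; apply: Apery_summand Air.
Qed.

Lemma graded_wilf d (h : 'I_d -> nat) :
    (forall i, 0 < h i) -> (forall i, S (h i)) ->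
    (forall a, Apery S m a -> exists u, dot h u = a) ->
  genus S * d.+1 <= d * c.
Proof.
move=> h_gt0 Sh A_gen.
have A_down (u v : 'I_d -> nat) : (forall i, v i <= u i) ->
    inA (dot h u) -> inA (dot h v).
  move=> vu /asboolP Au; apply/asboolP.
  have Sd w := semigroup_dot w Sh.
  apply: (Apery_summand (Sd v) (Sd (fun i => u i - v i))).
  rewrite -dotD; rewrite (eq_dot h (v := u)) // => i /=.
  by rewrite subnKC.
have A_le a : inA a -> a <= c + m by move=> /asboolP /Apery_lt /ltnW.
have sum_le : d.+1 * \sum_(a < (c + m).+1 | inA a) level a <=
    d * (#|[set a : 'I_(c + m).+1 | inA a]| * n0).
  apply: (@graded_sum_le d (c + m) h inA (fun a => level a)) => //.
  - by move=> a /asboolP; apply: A_gen.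
  - by move=> u /asboolP; apply: level_dot.
  - by move=> a /asboolP; apply: Apery_level_le.
have := genus_card_below; have := sum_colevel_le; have := card_Apery_ge.
set LA := #|[set s : 'I_c | _]|; set a := #|_| in sum_le *.
set X := \sum_(_ < _ | _) level _ in sum_le.
have : \sum_(a < (c + m).+1 | inA a) (n0 - level a) + X = a * n0.
  rewrite -big_split /= /a -sum_nat_const.
  apply: eq_big => [b|b /asboolP /Apery_level_le bn]; first by rewrite inE.
  by rewrite subnK.
set Y := \sum_(_ < _ | _) _ => XY m_le YL gL; have [cE _] := rho_bound.
(* c <= n0 m <= n0 |A| = (d + 1) n0 |A| - d n0 |A| <= (d + 1) (n0 |A| - X),
   and n0 |A| - X = Y is at most the number of elements of S below c. *)
have c_le : c <= a * n0 by nia.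
nia.
Qed.

End Graded.

End AperySet.

(** Removing 0 from a generating set does not change the monoid it spans. *)
Lemma minimal_generators_neq0 S G : minimal_generating_set S G -> ~ G 0.
Proof.
move=> [<- G_min] G0.
have /G_min H : (G `\ 0 `<=` G)%classic by move=> x [].
suff G0E : (G `\ 0)%classic = G by move: G0; rewrite -G0E => -[_]; apply.
apply: H; apply/seteqP; split=> _ [s sG <-].
  by exists s => // x /sG[].
exists [seq x <- s | x != 0] => [x|]; last by elim: s {sG} => //= -[|x] s /= ->.
by rewrite mem_filter => /andP[/eqP x0 /sG].
Qed.

(** Separating the multiples of the first generator: an element of the Apery set
    only admits such expressions with k = 0. *)
Lemma monoid_span_tuple d (g : d.+1.-tuple nat) x :
    monoid_span [set x | x \in g]%classic x ->
  exists k u, x = k * tnth g ord0 + dot (fun j => tnth g (lift ord0 j)) u.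
Proof.
move=> [s sg <-]; elim: s sg => [_|y s IHs sg].
  by exists 0, (fun=> 0); rewrite mul0n /dot big1.
have [|k [u /= ->]] := IHs; first by move=> z zs; apply: sg; rewrite inE zs orbT.
have /tnthP[i ->] : y \in g by apply: sg; rewrite mem_head.
have [j ->|->] := unliftP ord0 i; last first.
  by exists k.+1, u; rewrite mulSn addnA.
exists k, (fun l => (l == j) + u l); rewrite dotD addnCA; congr (_ + (_ + _)).
by rewrite /dot (bigD1 j) //= eqxx mul1n big1 ?addn0 // => l /negPf ->.
Qed.

Theorem proposition4p1 (S : set nat) (d : nat) (g : d.+1.-tuple nat) (c : nat)
    (S_sgp : numerical_semigroup S)
    (S_neqN : S <> setT)
    (g_incr : sorted ltn g)
    (g_min : minimal_generating_set S [set x | x \in g]%classic)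
    (c_cond : is_conductor S c)
    (S_graded : A_graded S (tnth g ord0) c) :
  ((genus S)%:R / c%:R <= d%:R / (d.+1)%:R :> rat)%R.
Proof.
have g_gt0 i : 0 < tnth g i.
  rewrite lt0n; apply/eqP => gi0; apply: (minimal_generators_neq0 g_min).
  by rewrite /= -gi0 mem_tnth.
have Sg i : S (tnth g i).
  rewrite -g_min.1; exists [:: tnth g i]; last by rewrite /= addn0.
  by move=> x; rewrite inE => /eqP ->; apply: mem_tnth.
have c_gt0 : 0 < c.
  rewrite lt0n; apply/eqP => c0; apply: S_neqN; apply/seteqP; split=> // n _.
  by apply: c_cond.1; rewrite c0.
have wilf : genus S * d.+1 <= d * c.
  apply: (graded_wilf S_sgp (g_gt0 ord0) (Sg ord0) c_cond S_graded
    (h := fun j => tnth g (lift ord0 j))) => // a [Sa notS].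
  have := Sa; rewrite -{1}g_min.1 => /monoid_span_tuple[[|k] [u aE]].
    by exists u.
  case: notS; rewrite aE mulSn -addnA leq_addr addKn; split=> //.
  have [_ SD _] := S_sgp; apply: SD; first exact: semigroupMn.
  exact: semigroup_dot.
by rewrite ler_pdivrMr ?ltr0n // mulrAC ler_pdivlMr ?ltr0n // -!natrM ler_nat.
Qed.
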